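(* Let $(W,S)$ be an arbitrary Coxeter system and let $\omega=(\omega_1,\dots,\omega_m)$ and $\zeta=(\zeta_1,\dots,\zeta_m)$ be two finite words in the generators $S$ that differ by the exchange of commuting generators in positions $i$ and $i+1$ (that is, $\omega_i=\zeta_{i+1}$, $\omega_{i+1}=\zeta_i$, $\omega_i\omega_{i+1}=\omega_{i+1}\omega_i$ in $W$, and $\omega_j=\zeta_j$ for $j\notin\{i,i+1\}$). Then $W_\omega=W_\zeta$ and for all $u,w\in W_\omega=W_\zeta$, $$u\leq_\omega w\iff u\leq_\zeta w.$$
   Context: $\ell$ denotes the length function of $(W,S)$. For a finite word $\omega=(\omega_1,\dots,\omega_m)$ in $S$, a subword $\alpha\subseteq\omega$ is identified with its index set $I(\alpha)=\{i_1<\dots<i_k\}\subseteq I(\omega)=\{1,\dots,m\}$, with $\alpha=(\omega_{i_1},\dots,\omega_{i_k})$. For a word $\alpha=(\alpha_1,\dots,\alpha_k)$ write $\langle\alpha\rangle=\alpha_1\cdots\alpha_k\in W$; $\alpha$ is reduced if $k=\ell(\langle\alpha\rangle)$. $W_\omega\subseteq W$ is the set of elements $\langle\alpha\rangle$ for subwords $\alpha\subseteq\omega$. For $A,B\subseteq I(\omega)$, $A\leq_{\mathsf{lex}}B$ means $A=B$ or $\min((A\cup B)\setminus(A\cap B))\in A$. For $u\in W_\omega$, the $\omega$-sorted word $\mathsf{sort}_\omega(u)$ is the subword of $\omega$ whose index set is $\leq_{\mathsf{lex}}$-minimum among index sets of subwords of $\omega$ that are reduced words for $u$. The $\omega$-sorting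 order on $W_\omega$ is: $u\leq_\omega w$ iff $I(\mathsf{sort}_\omega(u))\subseteq I(\mathsf{sort}_\omega(w))$. The order $\leq_\zeta$ on $W_\zeta$ is defined the same way from $\zeta$. *)

(* Defs.v *)
From mathcomp Require Import all_boot all_order all_fingroup.
From mathcomp Require Import boolp classical_sets.

Set Implicit Arguments.
Unset Strict Implicit.
Unset Printing Implicit Defensive.

Local Open Scope group_scope.

Definition is_word (W : groupType) (S : set W) (a : seq W) : Prop :=
  forall s, s \in a -> S s.

Definition word_prod (W : groupType) (a : seq W) : W := \prod_(s <- a) s.

(* [m s t = 0] encodes m(s,t) = oo; values of [m] outside [S] are irrelevant. *)
Definition is_coxeter_matrix (W : groupType) (S : set W) (m : W -> W -> nat)
    : Prop :=
  [/\ forall s, S s -> m s s = 1%N,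
      forall s t, S s -> S t -> m s t = m t s &
      forall s t, S s -> S t -> s <> t -> m s t <> 1%N].

(* f sends each relator (s t)^{m(s,t)} with m(s,t) finite to 1; for
   m(s,t) = oo the exponent is 0 and the condition is void. *)
Definition coxeter_relations (W : groupType) (S : set W) (m : W -> W -> nat)
    (G : groupType) (f : W -> G) : Prop :=
  forall s t, S s -> S t -> (f s * f t) ^+ m s t = 1.

(* W is presented by < S | (s t)^{m(s,t)} = 1 >, phrased by the universal
   property.  As the relators include s^2 (from m(s,s) = 1), words in S without
   inverse letters suffice in the generation clause.  S may be infinite. *)
Definition is_coxeter_system (W : groupType) (S : set W) : Prop :=
  exists m : W -> W -> nat,
    [/\ is_coxeter_matrix S m,
        forall w : W, exists2 a : seq W, is_word S a & word_prod a = w,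
        coxeter_relations S m (fun s : W => s) &
        forall (G : groupType) (f : W -> G), coxeter_relations S m f ->
          exists2 phi : W -> G, monoid_morphism phi &
            forall s, S s -> phi s = f s].

Definition has_word_of_size (W : groupType) (S : set W) (w : W) (k : nat)
    : Prop :=
  exists a : seq W, [/\ is_word S a, size a = k & word_prod a = w].

(* The default 0 is only returned when w is not a product of letters of S. *)
Definition cox_length (W : groupType) (S : set W) (w : W) : nat :=
  xget 0%N [set k : nat | has_word_of_size S w k /\
                          forall j, has_word_of_size S w j -> (k <= j)%N]%classic.

Definition reduced (W : groupType) (S : set W) (a : seq W) : bool :=
  size a == cox_length S (word_prod a).

(* Index sets are 0-based; [enum A] lists A : {set 'I_m} in increasing order. *)
Definition subword (W : groupType) (m : nat) (omega : m.-tuple W)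
    (A : {set 'I_m}) : seq W :=
  [seq tnth omega i | i <- enum A].

Definition subword_elements (W : groupType) (m : nat) (omega : m.-tuple W)
    : set W :=
  [set u : W | exists A : {set 'I_m}, word_prod (subword omega A) = u]%classic.

Definition lex_le (m : nat) (A B : {set 'I_m}) : bool :=
  let D := (A :|: B) :\: (A :&: B) in
  (A == B) ||
  [exists i : 'I_m, [&& i \in D, [forall j in D, (i <= j)%N] & i \in A]].

Definition reduced_subword_for (W : groupType) (S : set W) (m : nat)
    (omega : m.-tuple W) (u : W) (A : {set 'I_m}) : bool :=
  reduced S (subword omega A) && (word_prod (subword omega A) == u).

(* Index set of sort_omega(u).  The default is only returned when no subword
   of omega is a reduced word for u. *)
Definition sort_index (W : groupType) (S : set W) (m : nat)
    (omega : m.-tuple W) (u : W) : {set 'I_m} :=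
  odflt (finset.set0)
    [pick A : {set 'I_m} | reduced_subword_for S omega u A &
       [forall B : {set 'I_m}, reduced_subword_for S omega u B ==> lex_le A B]].

Definition sorting_le (W : groupType) (S : set W) (m : nat)
    (omega : m.-tuple W) (u w : W) : bool :=
  sort_index S omega u \subset sort_index S omega w.

(* Main.v *)
(** Transposing positions [i], [i'] carries reduced subwords of [omega] for [u] to
    reduced subwords of [zeta] for [u], and it respects the lexicographic order
    except when two index sets agree below [i] and meet [{i, i'}] in [{i}] and
    [{i'}] respectively.  In that case the words read [P s X] and [P t Y] with
    [s X = t Y]; as [s] and [t] commute, [t] is a left descent of [X], so by exchange
    [X = t X'] with [X'] obtained by deleting a letter, and [P s t X'] is a reduced
    subword lexicographically smaller than both.  Hence the transposition carries
    sorted words to sorted words.  The exchange property comes from the cocycle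
    [N] : [W] -> functions from [W] to [Z/2], built by extending
    [s |-> (indicator of s, s)] to a morphism into the semidirect product. *)
From HB Require Import structures.
Require Import Defs.
From mathcomp Require Import all_boot all_order all_fingroup.
From mathcomp Require Import boolp classical_sets.

Set Implicit Arguments.
Unset Strict Implicit.
Unset Printing Implicit Defensive.

Local Open Scope group_scope.

(** * The semidirect product of the functions [W -> Z/2] by [W] *)

Definition reflection_ext (W : groupType) : Type := ((W -> bool) * W)%type.

Section ReflectionExt.
Variable W : groupType.
Implicit Types x y z : reflection_ext W.

Definition rext_one : reflection_ext W := (fun=> false, 1).
(** Here [bool] under [addb] is Z/2, and [W] acts on functions from the left through conjugation of
    their argument. *)
Definition rext_mul x y : reflection_ext W :=
  (fun r => x.1 r (+) y.1 (r ^ x.2), x.2 * y.2).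
Definition rext_inv x : reflection_ext W := (fun r => x.1 (r ^ x.2^-1), x.2^-1).

Lemma rext_mulA : associative rext_mul.
Proof.
move=> x y z; congr pair => /=; last by rewrite mulgA.
by apply/funext => r; rewrite conjgM addbA.
Qed.

Lemma rext_mul1 : left_id rext_one rext_mul.
Proof.
case=> p u; congr pair => /=; last by rewrite mul1g.
by apply/funext => r; rewrite conjg1.
Qed.

Lemma rext_mulr1 : right_id rext_one rext_mul.
Proof.
case=> p u; congr pair => /=; last by rewrite mulg1.
by apply/funext => r; rewrite addbF.
Qed.

Lemma rext_mulV : left_inverse rext_one rext_inv rext_mul.
Proof.
case=> p u; congr pair => /=; last by rewrite mulVg.
by apply/funext => r; rewrite addbb.
Qed.

Lemma rext_mulrV : right_inverse rext_one rext_inv rext_mul.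
Proof.
case=> p u; congr pair => /=; last by rewrite mulgV.
by apply/funext => r; rewrite -conjgM mulgV conjg1 addbb.
Qed.

HB.instance Definition _ := Choice.copy (reflection_ext W) ((W -> bool) * W)%type.
HB.instance Definition _ := isGroup.Build (reflection_ext W)
  rext_mulA rext_mul1 rext_mulr1 rext_mulV rext_mulrV.

Definition rext_gen (s : W) : reflection_ext W := (fun r => r == s, s).

Lemma conjg_eqE (r x y : W) : (r ^ x == y) = (r == y ^ x^-1).
Proof. exact: (can2_eq (conjgK x) (conjgKV x)). Qed.

(* In the word (s,t,s,t,...), the letter of index j (from 0) carries the
   reflection (st)^j s. *)
Lemma rext_gen_expg (s t : W) k : s * s = 1 -> t * t = 1 ->
  (rext_gen s * rext_gen t) ^+ k =
  (fun r => \big[addb/false]_(j < k.*2) (r == (s * t) ^+ j * s), (s * t) ^+ k).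
Proof.
move=> ss tt; set c := s * t.
(* Conjugation by [s] inverts [c]. This brings the conjugates of [s] and [t] that arise below into
   the form [c ^+ j * s]. *)
have flip n : c ^+ n * s * c ^+ n = s.
  elim: n => [|n IH]; first by rewrite mul1g mulg1.
  rewrite [X in X * s]expgSr expgS -[RHS]IH !mulgA; congr (_ * _).
  rewrite -!mulgA; congr (_ * _).
  by rewrite (mulgA s s) ss mul1g tt mulg1.
have conj_s n : s ^ (c ^+ n)^-1 = c ^+ n.*2 * s.
  rewrite conjgE invgK -[X in c ^+ n * (X * _)](flip n) -addnn expgD.
  by rewrite !mulgA mulgK.
have conj_t n : t ^ (c ^+ n * s)^-1 = c ^+ n.*2.+1 * s.
  have ts : t ^ s^-1 = c * s by rewrite conjgE invgK mulgA (mulg1_eq ss).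
  have cc : c ^ (c ^+ n)^-1 = c.
    by rewrite conjgE invgK mulgA -expgSr expgS mulgK.
  by rewrite invMg conjgM ts conjMg conj_s cc expgS mulgA.
elim: k => [|k IH].
  by congr pair; apply/funext => r; rewrite big_ord0.
rewrite expgSr IH; congr pair => /=; last by rewrite -expgSr.
apply/funext => r.
(* The new factor supplies the letters of index 2k and 2k+1, whose indicators are evaluated at
   [r ^ (c ^+ k)] and at its conjugate by [s]. *)
rewrite doubleS !big_ord_recr /= -addbA; congr (_ (+) (_ (+) _)).
  by rewrite conjg_eqE conj_s.
by rewrite -conjgM conjg_eqE conj_t.
Qed.

End ReflectionExt.

(** For a word [s_1 ... s_n] with product [w], these rules make [N w r] the parity of the number of
    [j] with [r = s_1 ... s_(j-1) s_j s_(j-1) ... s_1]. *)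
Definition reflection_cocycle (W : groupType) (S : set W) (N : W -> W -> bool) :=
  (forall r, N 1 r = false) /\
  forall s w r, S s -> N (s * w) r = (r == s) (+) N w (r ^ s).

(** * The reflection cocycle and the exchange property *)

Section CoxeterSystem.
Variables (W : groupType) (S : set W).
Hypothesis hS : is_coxeter_system S.

Lemma coxeter_gen_invol s : S s -> s * s = 1.
Proof.
by case: hS => M [[Mss _ _] _ rel _] Ss; have := rel s s Ss Ss; rewrite Mss.
Qed.

Lemma reflection_cocycle_exists : exists N, reflection_cocycle S N.
Proof.
case: hS => M [_ _ rel univ].
have [|phi [phi1 phiM] phiS] := univ _ (@rext_gen W).
  move=> s t Ss St; rewrite rext_gen_expg ?coxeter_gen_invol // rel //.
  congr pair; apply/funext => r.
  (* The sum has 2m terms with m = [M s t]. Since [(s * t) ^+ m = 1], the terms j and j + m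
     coincide, so the two halves cancel mod 2; for m = 0 the sum is empty. *)
  rewrite -addnn -(big_mkord xpredT (fun j => r == (s * t) ^+ j * s)).
  rewrite (big_cat_nat (leq0n _) (leq_addr _ _)) -{2}[M s t]add0n big_addn addnK.
  have -> : \big[addb/false]_(0 <= j < M s t) (r == (s * t) ^+ (j + M s t) * s) =
      \big[addb/false]_(0 <= j < M s t) (r == (s * t) ^+ j * s).
    by apply: eq_bigr => j _; rewrite expgD rel // mulg1.
  exact: addbb.
exists (fun w => (phi w).1); split=> [r|s w r Ss]; first by rewrite phi1.
by rewrite phiM phiS.
Qed.

Section Exchange.
Variables (I : eqType) (g : I -> W).
Hypothesis Sg : forall i, S (g i).

(** An odd count means that [r] is the reflection attached to some position [j], and multiplying by
    it on the left deletes that letter. Products run over indices filtered by a predicate, so that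
    the deletion reads as the removal of an index from an index set. *)
Lemma cocycle_exchange N (P : pred I) (l : seq I) (r : W) :
  reflection_cocycle S N -> uniq l -> N (\prod_(k <- l | P k) g k) r ->
  exists j, [/\ j \in l, P j &
    r * \prod_(k <- l | P k) g k = \prod_(k <- l | P k && (k != j)) g k].
Proof.
case=> N1 NM; elim: l r => [|i l IH] r; first by rewrite big_nil N1.
rewrite cons_uniq big_cons => /andP[il Ul].
case: ifP => [Pi|nPi]; last first.
  case/(IH _ Ul) => j [jl Pj ->]; exists j; split=> //.
    by rewrite inE jl orbT.
  by rewrite big_cons nPi.
rewrite NM //; have [-> _|_ /(IH _ Ul)[j [jl Pj Ej]]] := eqVneq r (g i).
  exists i; rewrite mem_head Pi mulgA coxeter_gen_invol // mul1g; split=> //.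
  rewrite big_cons eqxx andbF big_seq_cond [RHS]big_seq_cond.
  apply: eq_bigl => k; case: (boolP (k \in l)) => //= kl.
  by rewrite (memPn il) ?andbT.
exists j; rewrite inE jl orbT; split=> //.
(* Moving [r] past the first letter conjugates it, which is the argument at which the induction
   hypothesis applies. *)
by rewrite mulgA (conjgC r) -mulgA Ej big_cons Pi eq_sym (memPn il).
Qed.

(** Write X and Y for the products over [P] and [Q]. Evaluating the cocycle of [s X = t Y] at [t],
    which [s] centralizes, gives [N X t = 1 + N Y t], so [t] can be exchanged into one of X and
    Y. *)
Lemma commuting_descents (P Q : pred I) (l : seq I) (s t : W) :
  uniq l -> S s -> S t -> s <> t -> s * t = t * s ->
  s * \prod_(k <- l | P k) g k = t * \prod_(k <- l | Q k) g k ->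
  (exists j, [/\ j \in l, Q j &
    t * \prod_(k <- l | Q k) g k = \prod_(k <- l | Q k && (k != j)) g k]) \/
  (exists j, [/\ j \in l, P j &
    t * \prod_(k <- l | P k) g k = \prod_(k <- l | P k && (k != j)) g k]).
Proof.
move=> Ul Ss St /eqP neq_st cst E.
have [N HN] := reflection_cocycle_exists; have [_ NM] := HN.
have conj_t x : x * t = t * x -> t ^ x = t by move=> C; rewrite conjgE -C mulKg.
have := congr1 (N^~ t) E; rewrite /= !NM // !conj_t // eqxx eq_sym (negPf neq_st).
case NY: (N (\prod_(k <- l | Q k) g k) t) => /= NX.
  by left; apply: cocycle_exchange NY.
by right; apply: cocycle_exchange NX.
Qed.

End Exchange.

Lemma cox_length_le (a : seq W) :
  is_word S a -> (cox_length S (word_prod a) <= size a)%N.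
Proof.
move=> Sa; rewrite /cox_length.
set P := (X in xget _ X).
have exP : exists k, `[< has_word_of_size S (word_prod a) k >].
  by exists (size a); apply/asboolP; exists a.
have : P (xget 0%N P).
  (* A least word size exists, so [xget] does not fall back on its default 0. *)
  apply: xgetPex; case: (ex_minnP exP) => k /asboolP Pk mink.
  by exists k; split=> // j Pj; apply: mink; apply/asboolP.
by case=> _; apply; exists a.
Qed.

End CoxeterSystem.

(** * Subwords as index sets and their lexicographic order *)

Section Subwords.
Variables (W : groupType) (m : nat).
Implicit Types (omega zeta : m.-tuple W) (A B : {set 'I_m}).

Lemma size_subword omega A : size (subword omega A) = #|A|.
Proof. by rewrite size_map -cardE. Qed.

Lemma word_prod_subword omega A :
  word_prod (subword omega A) = \prod_(k <- enum 'I_m | k \in A) tnth omega k.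
Proof. by rewrite /word_prod big_map big_filter enumT. Qed.

Lemma cox_length_subword_le (S : set W) omega A :
  is_word S omega -> (cox_length S (word_prod (subword omega A)) <= #|A|)%N.
Proof.
move=> Sw; rewrite -(size_subword omega); apply: cox_length_le => _ /mapP[k _ ->].
exact/Sw/mem_tnth.
Qed.

Lemma enum_ord_split (i i' : 'I_m) : i' = i.+1 :> nat ->
  exists pre post, [/\ enum 'I_m = pre ++ i :: i' :: post,
    forall k, k \in pre -> (k < i)%N & forall k, k \in post -> (i' < k)%N].
Proof.
move=> hi; exists (take i (enum 'I_m)), (drop i.+2 (enum 'I_m)); split.
- rewrite -{1}(cat_take_drop i (enum 'I_m)) (drop_nth i) ?size_enum_ord //.
  by rewrite -hi (drop_nth i) ?size_enum_ord // !nth_ord_enum.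
- move=> k /(map_f val); rewrite map_take val_enum_ord take_iota mem_iota /=.
  by rewrite add0n ltn_min => /andP[].
- move=> k /(map_f val); rewrite map_drop val_enum_ord drop_iota mem_iota -hi.
  by case/andP.
Qed.

Lemma lex_leP A B :
  reflect (A = B \/ exists k, [/\ k \in A, k \notin B &
                    forall j : 'I_m, (j < k)%N -> (j \in A) = (j \in B)])
          (lex_le A B).
Proof.
rewrite /lex_le; set D := _ :\: _.
have inD k : (k \in D) = ((k \in A) != (k \in B)).
  by rewrite !inE; do 2![case: (_ \in _)].
apply: (iffP orP) => [[/eqP->|/existsP[k /and3P[kD /forall_inP kmin kA]]]|].
- by left.
- right; exists k; split=> //; first by rewrite inD kA in kD; case: (k \in B) kD.
  move=> j jk; apply/eqP; apply: contraTT jk => jD.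
  by rewrite -leqNgt kmin // inD.
case=> [->|[k [kA kB kmin]]]; first by left.
right; apply/existsP; exists k; rewrite inD kA (negPf kB) /= andbT.
apply/forall_inP => j; rewrite inD leqNgt; apply: contraNN => jk.
by rewrite kmin.
Qed.

Lemma lex_le_anti A B : lex_le A B -> lex_le B A -> A = B.
Proof.
case/lex_leP => // -[k [kA kB kmin]] /lex_leP[//|[l [lB lA lmin]]].
case: (ltngtP k l) => [kl|lk|/val_inj E].
- by rewrite lmin // kA in kB.
- by rewrite kmin // lB in lA.
- by rewrite E lB in kB.
Qed.

End Subwords.


(** * Transposing two adjacent commuting letters *)

Section CommutingSwap.
Variables (W : groupType) (S : set W).
Hypothesis hS : is_coxeter_system S.
Variables (m : nat) (i i' : 'I_m).
Hypothesis hi : i' = i.+1 :> nat.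
Implicit Types (omega zeta : m.-tuple W) (A B : {set 'I_m}).

Definition commuting_swap omega zeta : Prop :=
  [/\ tnth omega i = tnth zeta i', tnth omega i' = tnth zeta i,
      tnth omega i * tnth omega i' = tnth omega i' * tnth omega i &
      forall j, j <> i -> j <> i' -> tnth omega j = tnth zeta j].

Lemma commuting_swapC omega zeta :
  commuting_swap omega zeta -> commuting_swap zeta omega.
Proof.
by case=> Ei Ei' C E; split=> [|||j ji ji']; rewrite -?Ei -?Ei' // E.
Qed.

(** A preimage equals the image here, the transposition being an involution, and its membership
    unfolds directly. *)
Definition swap_set A : {set 'I_m} := tperm i i' @^-1: A.

Lemma swap_setK : involutive swap_set.
Proof. by move=> A; apply/setP => k; rewrite !inE tpermK. Qed.

Lemma card_swap_set A : #|swap_set A| = #|A|.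
Proof. exact/card_preimset/perm_inj. Qed.

Lemma swap_setS A B : (swap_set A \subset swap_set B) = (A \subset B).
Proof.
apply/idP/idP => [|sAB]; last exact: preimsetS.
by move/(preimsetS (tperm i i')); rewrite -!/(swap_set _) !swap_setK.
Qed.

Lemma in_swap_set_i A : (i \in swap_set A) = (i' \in A).
Proof. by rewrite inE tpermL. Qed.

Lemma in_swap_set_i' A : (i' \in swap_set A) = (i \in A).
Proof. by rewrite inE tpermR. Qed.

Lemma lt_ord_neq (j k : 'I_m) : (j < k)%N -> j != k.
Proof. by rewrite -val_eqE neq_ltn => ->. Qed.

Lemma tperm_lt (k : 'I_m) : (k < i)%N -> tperm i i' k = k.
Proof.
by move=> ki; rewrite tpermD // eq_sym lt_ord_neq // hi ltnS ltnW.
Qed.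

Lemma tperm_gt (k : 'I_m) : (i' < k)%N -> tperm i i' k = k.
Proof. by move=> ki; rewrite tpermD // lt_ord_neq // -ltnS -hi ltnW. Qed.

Lemma in_swap_set_lt A (k : 'I_m) : (k < i)%N -> (k \in swap_set A) = (k \in A).
Proof. by move=> ki; rewrite inE tperm_lt. Qed.

Lemma in_swap_set_gt A (k : 'I_m) : (i' < k)%N -> (k \in swap_set A) = (k \in A).
Proof. by move=> ki; rewrite inE tperm_gt. Qed.

Lemma word_prod_swap omega zeta A : commuting_swap omega zeta ->
  word_prod (subword zeta (swap_set A)) = word_prod (subword omega A).
Proof.
case=> Ei Ei' C E; rewrite !word_prod_subword.
have [pre [post [-> ltpre gtpost]]] := enum_ord_split hi.
have eq_away (l : seq 'I_m) :
    (forall k, k \in l -> tperm i i' k = k /\ tnth omega k = tnth zeta k) ->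
    \prod_(k <- l | k \in swap_set A) tnth zeta k =
    \prod_(k <- l | k \in A) tnth omega k.
  move=> fix_l; rewrite big_seq_cond [RHS]big_seq_cond; apply: eq_big => k.
    by case: (boolP (k \in l)) => //= /fix_l[fk _]; rewrite inE fk.
  by case/andP=> /fix_l[_ ->].
rewrite !big_cat !big_cons in_swap_set_i in_swap_set_i' -Ei -Ei' !eq_away.
(* The order of the two middle factors matters only when both positions are chosen; then they
   commute. *)
- by congr (_ * _); case: ifP; case: ifP => //= _ _; rewrite !mulgA C.
- move=> k /gtpost i'k; rewrite tperm_gt //; split=> //.
  by apply: E => Ek; move: i'k; rewrite Ek ?hi ?ltnn // ltnNge leqnSn.
- move=> k /ltpre ki; rewrite tperm_lt //; split=> //.
  by apply: E => Ek; move: ki; rewrite Ek ?hi ?ltnn // ltnNge leqnSn.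
Qed.

Lemma reduced_subword_forE omega u A :
  reduced_subword_for S omega u A =
  (word_prod (subword omega A) == u) && (#|A| == cox_length S u).
Proof.
rewrite /reduced_subword_for /reduced size_subword andbC.
by case: eqP => //= ->.
Qed.

Lemma reduced_subword_swap omega zeta u A : commuting_swap omega zeta ->
  reduced_subword_for S zeta u (swap_set A) = reduced_subword_for S omega u A.
Proof.
by move=> C; rewrite !reduced_subword_forE (word_prod_swap _ C) card_swap_set.
Qed.

(** Let [k] be the first difference. Outside the pair it stays put, and [k = i'] moves to [i]. If
    [k = i], it moves to [i'] when [A] and [B] agree at [i'], and remains at [i] when [i'] is in [A]
    only; the order is reversed only when [i'] is in [B] only. *)
Lemma lex_le_swap A B :
  lex_le A B ->
  lex_le (swap_set A) (swap_set B) \/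
  [/\ i \in A, i' \notin A, i \notin B, i' \in B &
      forall j : 'I_m, (j < i)%N -> (j \in A) = (j \in B)].
Proof.
case/lex_leP => [->|[k [kA kB kmin]]]; first by left; apply/lex_leP; left.
have lt_swap (j : 'I_m) : (j < i)%N -> (forall l : 'I_m, (l < i)%N -> (l \in A) = (l \in B)) ->
    (j \in swap_set A) = (j \in swap_set B).
  by move=> ji H; rewrite !in_swap_set_lt ?H.
have ltii' : (i < i')%N by rewrite hi.
case: (ltngtP k i) => [ki|ik|/val_inj Ek].
- left; apply/lex_leP; right; exists k; rewrite !in_swap_set_lt //; split=> // j jk.
  by rewrite !in_swap_set_lt ?(ltn_trans jk) ?kmin.
- have ltmin (l : 'I_m) : (l < i)%N -> (l \in A) = (l \in B).
    by move=> li; apply/kmin/(ltn_trans li).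
  left; apply/lex_leP; right; move: ik; rewrite -hi leq_eqVlt => /orP[/eqP/val_inj Ek|i'k].
    exists i; rewrite !in_swap_set_i Ek; split=> // j ji; exact: lt_swap ltmin.
  exists k; rewrite !in_swap_set_gt //; split=> // j jk.
  rewrite !inE; apply: kmin; case: tpermP => // _.
  exact: ltn_trans i'k.
subst k; case Ei'A: (i' \in A); last first.
  case Ei'B: (i' \in B); first by right; split=> //; rewrite ?Ei'A.
  left; apply/lex_leP; right; exists i'; rewrite !in_swap_set_i'; split=> // j.
  rewrite hi ltnS leq_eqVlt => /orP[/eqP/val_inj->|ji]; last exact: lt_swap kmin.
  by rewrite !in_swap_set_i Ei'A.
left; apply/lex_leP; right; case Ei'B: (i' \in B).
  exists i'; rewrite !in_swap_set_i'; split=> // j.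
  rewrite hi ltnS leq_eqVlt => /orP[/eqP/val_inj->|ji]; last exact: lt_swap kmin.
  by rewrite !in_swap_set_i Ei'A.
exists i; rewrite !in_swap_set_i Ei'A Ei'B; split=> // j ji; exact: lt_swap kmin.
Qed.

(** * Lexicographically minimal reduced subwords *)

Definition lex_min_reduced omega u A :=
  reduced_subword_for S omega u A &&
  [forall B : {set 'I_m}, reduced_subword_for S omega u B ==> lex_le A B].

(* If A and B agreed below i, with A meeting {i,i'} in i and B in i', then
   exchange would give a reduced subword containing both i and i', hence
   lexicographically smaller than A. *)
Lemma lex_min_no_crossing omega u A B :
  is_word S omega -> tnth omega i <> tnth omega i' ->
  tnth omega i * tnth omega i' = tnth omega i' * tnth omega i ->
  lex_min_reduced omega u A -> reduced_subword_for S omega u B ->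
  i \in A -> i' \notin A -> i \notin B -> i' \in B ->
  ~ forall j : 'I_m, (j < i)%N -> (j \in A) = (j \in B).
Proof.
move=> Sw neq C /andP[redA /forall_inP minA] redB iA i'A iB i'B agree.
have Sg k : S (tnth omega k) by apply/Sw/mem_tnth.
have [pre [post [Eenum ltpre gtpost]]] := enum_ord_split hi.
have ltii' : (i < i')%N by rewrite hi.
have Upost : uniq post.
  have := enum_uniq 'I_m; rewrite Eenum cat_uniq => /and3P[_ _].
  by rewrite !cons_uniq => /and3P[].
have split_prod D : word_prod (subword omega D) =
    \prod_(k <- pre | k \in D) tnth omega k *
    ((if i \in D then tnth omega i else 1) *
    ((if i' \in D then tnth omega i' else 1) *
    \prod_(k <- post | k \in D) tnth omega k)).
  rewrite word_prod_subword Eenum big_cat !big_cons /=.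
  by do 2![case: ifP => _]; rewrite ?mul1g.
have eq_pre (D : {set 'I_m}) : (forall j : 'I_m, (j < i)%N -> (j \in D) = (j \in A)) ->
    \prod_(k <- pre | k \in D) tnth omega k =
    \prod_(k <- pre | k \in A) tnth omega k.
  move=> H; rewrite big_seq_cond [RHS]big_seq_cond; apply: eq_bigl => k.
  by case: (boolP (k \in pre)) => //= /ltpre/H.
have eq_post (D : {set 'I_m}) (P : pred 'I_m) : (forall j : 'I_m, (i' < j)%N -> (j \in D) = P j) ->
    \prod_(k <- post | k \in D) tnth omega k =
    \prod_(k <- post | P k) tnth omega k.
  move=> H; rewrite big_seq_cond [RHS]big_seq_cond; apply: eq_bigl => k.
  by case: (boolP (k \in post)) => //= /gtpost/H.
have [/eqP prodA /eqP cardA] : word_prod (subword omega A) == u /\ #|A| == cox_length S u.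
  by apply/andP; rewrite -reduced_subword_forE.
have [/eqP prodB /eqP cardB] : word_prod (subword omega B) == u /\ #|B| == cox_length S u.
  by apply/andP; rewrite -reduced_subword_forE.
have E : tnth omega i * \prod_(k <- post | k \in A) tnth omega k =
         tnth omega i' * \prod_(k <- post | k \in B) tnth omega k.
  have := prodB; rewrite -prodA !split_prod iA (negPf i'A) (negPf iB) i'B !mul1g.
  rewrite (eq_pre B); last by move=> j /agree.
  by move/mulgI.
have lt_pre_post (k j : 'I_m) : (k < i)%N -> (i' < j)%N ->
    (k != i') * (k != j).
  move=> ki i'j; have ki' := ltn_trans ki ltii'.
  by rewrite !lt_ord_neq // (ltn_trans ki').
have [] := commuting_descents hS Sg Upost (Sg i) (Sg i') neq C E.
  (* If [t] exchanges into the tail of [B], deleting both [i'] and [j] leaves a word for [u] with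
     two letters fewer, against the reducedness of [B]. *)
  case=> j [/gtpost i'j jB Ej]; set B' := B :\ i' :\ j.
  have nji' : j != i' by rewrite eq_sym lt_ord_neq.
  have prodB' : word_prod (subword omega B') = u.
    rewrite -prodB !split_prod !inE eqxx (negPf iB) i'B !andbF /= !mul1g.
    rewrite (eq_pre B') => [|k ki]; last first.
      by have [ki' kj] := lt_pre_post _ _ ki i'j; rewrite !inE ki' kj agree.
    rewrite (eq_pre B) => [|k /agree//].
    rewrite Ej (eq_post B' (fun k => (k \in B) && (k != j))) // => k i'k.
    by rewrite !inE andbC (eq_sym k i') lt_ord_neq.
  have := cox_length_subword_le B' Sw.
  rewrite prodB' -cardB (cardsD1 i' B) i'B (cardsD1 j (B :\ i')) !inE jB nji'.
  by rewrite -/B' !add1n ltnNge leqnSn.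
(* Otherwise the tail of [A] is [t] times itself without [j], so trading [j] for [i'] keeps both the
   product and the cardinality. *)
case=> j [/gtpost i'j jA Ej]; set A' := i' |: (A :\ j).
have nji' : j != i' by rewrite eq_sym lt_ord_neq.
have nji : j != i by rewrite eq_sym lt_ord_neq // (ltn_trans ltii').
have prodA' : word_prod (subword omega A') = u.
  rewrite -prodA !split_prod !inE eqxx iA (negPf i'A) (negPf (lt_ord_neq ltii')).
  rewrite (eq_sym i) nji /= mul1g (eq_pre A') => [|k ki]; last first.
    by have [ki' kj] := lt_pre_post _ _ ki i'j; rewrite !inE (negPf ki') kj.
  rewrite (eq_post A' (fun k => (k \in A) && (k != j))) => [|k i'k]; last first.
    by rewrite !inE andbC (eq_sym k i') (negPf (lt_ord_neq i'k)).
  rewrite -Ej; congr (_ * (_ * _)).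
  by rewrite mulgA (coxeter_gen_invol hS (Sg i')) mul1g.
have redA' : reduced_subword_for S omega u A'.
  rewrite reduced_subword_forE prodA' eqxx /= -cardA cardsU1 (cardsD1 j A) jA.
  by rewrite !inE (negPf i'A) andbF.
(* The only index of [A] outside [A'] is [j], so it would have to be the first difference; but
   [i' < j] lies in [A'] and not in [A]. *)
case/lex_leP: (minA _ redA') => [EA|[k [kA kA' kmin]]].
  by move: i'A; rewrite EA !inE eqxx.
have Ek : k = j.
  by move: kA'; rewrite !inE kA andbT negb_or negbK => /andP[_ /eqP].
by move: i'A; rewrite kmin ?Ek // !inE eqxx.
Qed.

Lemma lex_min_swap omega zeta u A :
  is_word S omega -> tnth omega i <> tnth omega i' -> commuting_swap omega zeta ->
  lex_min_reduced omega u A -> lex_min_reduced zeta u (swap_set A).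
Proof.
move=> Sw neq C minA; have /andP[redA /forall_inP leA] := minA.
apply/andP; split; first by rewrite (reduced_subword_swap _ _ C).
apply/forall_inP => B; rewrite -(swap_setK B) (reduced_subword_swap _ _ C) => redB.
have [//|[iA i'A iB i'B agree]] := lex_le_swap (leA _ redB).
case: C => _ _ C _; have [] := lex_min_no_crossing Sw neq C minA redB iA i'A iB i'B agree.
Qed.

(** [lex_min_swap], used in both directions, makes the two picks succeed or fail together;
    antisymmetry of [lex_le] then identifies the picked sets. *)
Lemma sort_index_swap omega zeta u :
  is_word S omega -> is_word S zeta ->
  tnth omega i <> tnth omega i' -> commuting_swap omega zeta ->
  sort_index S zeta u = swap_set (sort_index S omega u).
Proof.
move=> Sw Sz neq C; have C' := commuting_swapC C.
have neq' : tnth zeta i <> tnth zeta i' by case: C => <- <- _ _; apply: nesym.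
rewrite /sort_index; case: pickP => /= [A minA|no_zeta];
  case: pickP => /= [B minB|no_omega].
- have /andP[redA /forall_inP leA] := minA.
  have /andP[redB /forall_inP leB] := lex_min_swap Sw neq C minB.
  exact: lex_le_anti (leA _ redB) (leB _ redA).
- by have := no_omega (swap_set A); rewrite -/(lex_min_reduced _ _ _) (lex_min_swap Sz neq' C').
- by have := no_zeta (swap_set B); rewrite -/(lex_min_reduced _ _ _) (lex_min_swap Sw neq C).
(* Both picks fail: both values are the default empty set, which the swap fixes. *)
by rewrite /swap_set preimset0.
Qed.

Lemma subword_elements_swap omega zeta : commuting_swap omega zeta ->
  (subword_elements omega `<=` subword_elements zeta)%classic.
Proof. by move=> C u [A <-]; exists (swap_set A); apply: word_prod_swap. Qed.

End CommutingSwap.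

Theorem lemma4p7 (W : groupType) (S : set W) (hS : is_coxeter_system S)
    (m : nat) (omega zeta : m.-tuple W)
    (homega : is_word S omega) (hzeta : is_word S zeta)
    (i i' : 'I_m) (hi : nat_of_ord i' = i.+1)
    (hswap : tnth omega i = tnth zeta i')
    (hswap' : tnth omega i' = tnth zeta i)
    (hcomm : (tnth omega i * tnth omega i' = tnth omega i' * tnth omega i)%g)
    (hother : forall j : 'I_m, j <> i -> j <> i' -> tnth omega j = tnth zeta j) :
  subword_elements omega = subword_elements zeta /\
  forall u w : W, subword_elements omega u -> subword_elements omega w ->
    (sorting_le S omega u w <-> sorting_le S zeta u w).
Proof.
have C : commuting_swap i i' omega zeta by [].
split=> [|u w _ _].
  apply/seteqP; split; first exact: (subword_elements_swap hi C).
  exact: (subword_elements_swap hi (commuting_swapC C)).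
(* Equal letters are treated apart: the words then coincide, whereas the swap would send the sorted
   index set of [s] in [(s, s)] from the first position to the second. *)
have [eq_gen|/eqP neq] := eqVneq (tnth omega i) (tnth omega i').
  suff -> : omega = zeta by [].
  apply: eq_from_tnth => j.
  have [->|/eqP ji] := eqVneq j i; first by rewrite eq_gen hswap'.
  have [->|/eqP ji'] := eqVneq j i'; first by rewrite -eq_gen hswap.
  exact: hother.
by rewrite /sorting_le !(sort_index_swap hS hi _ homega hzeta neq C) swap_setS.
Qed.
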